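(* Let $p$ be a prime with $p\mid F_{p+1}$, and for $n\ge1$ let $R_n$ be the $n\times n$ matrix with $(i,j)$ entry $\binom{i-1}{n-j}$. Then $R_{2k+1}^{\,p+1}\equiv I_{2k+1}\pmod p$ for every $k\ge0$, and $R_{2k}^{\,p+1}\equiv -I_{2k}\pmod p$ for every $k\ge1$.
   Context: Convention: $\binom{m}{k}=0$ if $k<0$ or $k>m$. The Fibonacci sequence is $F_0=0$, $F_1=1$, $F_{m+1}=F_m+F_{m-1}$. Matrix congruences modulo $p$ are entrywise; $I_n$ is the identity matrix. *)

(* Defs.v *)
From mathcomp Require Import all_boot all_order all_algebra.

Set Implicit Arguments.
Unset Strict Implicit.
Unset Printing Implicit Defensive.

Import GRing.Theory.
Local Open Scope ring_scope.

Fixpoint fib (m : nat) : nat :=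
  match m with
  | 0 => 0
  | 1 => 1
  | (m'.+1 as m1).+1 => fib m1 + fib m'
  end.

(* With 1-based indices the (i, j) entry is 'C(i - 1, n - j); ordinals are
   0-based, so i - 1 becomes i and n - j becomes n - j.+1.  The latter
   subtraction never truncates, because j < n. *)
Definition Rmat (n : nat) : 'M[int]_n :=
  \matrix_(i < n, j < n) ('C(i, n - j.+1)%N)%:Z.

Definition eqmod_mx (p m n : nat) (A B : 'M[int]_(m, n)) : Prop :=
  forall (i : 'I_m) (j : 'I_n), (A i j = B i j %[mod p%:Z])%Z.

(* Main.v *)
(* On the vectors [v a b = (a ^ N, a ^ (N - 1) * b, ..., b ^ N)] the matrix
   [Rmat N.+1] acts by [v a b |-> v b (a + b)], so its powers are governed by
   the Fibonacci recurrence.  If [p] divides [fib p.+1], then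
   [fib p = -1] modulo [p], so the [p.+1]-st power sends [v 1 X] to
   [v (-1) (- X) = (-1) ^ N v 1 X], and comparing coefficients of [X]
   identifies the matrix.
   The value of [fib p] comes from Frobenius: [Q = [[0, 1], [1, 1]]] and [1 - Q]
   commute and both satisfy [x ^ 2 = x + 1], so that
   [1 = (Q + (1 - Q)) ^ p = Q ^ p + (1 - Q) ^ p = fib p + 2 fib (p - 1)]. *)

Require Import Defs.
From mathcomp Require Import all_boot all_order all_algebra.
Import GRing.Theory.

Local Open Scope ring_scope.

(** The index is shifted to [m.+1] because the coefficients for [g 0] would involve [F_{-1}]. *)
Lemma fib_recurrence (V : nmodType) (g : nat -> V)
    (hg : forall m, g m.+2 = g m + g m.+1) (m : nat) :
  g m.+1 = g 0%N *+ fib m + g 1%N *+ fib m.+1.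
Proof.
suff [] : g m.+1 = g 0%N *+ fib m + g 1%N *+ fib m.+1 /\
          g m.+2 = g 0%N *+ fib m.+1 + g 1%N *+ fib m.+2 by [].
elim: m => [|m [IH1 IH2]]; first by split; rewrite ?hg /= ?add0r.
split=> //; rewrite hg {}IH1 {}IH2 addrACA -!mulrnDr.
by rewrite [X in g 0%N *+ X]addnC [X in g 1%N *+ X]addnC.
Qed.

Lemma expr_golden (A : pzRingType) (x : A) (m : nat) :
  x ^+ 2 = 1 + x -> x ^+ m.+1 = (fib m)%:R + x *+ fib m.+1.
Proof.
move=> hx; apply: (@fib_recurrence _ (fun m => x ^+ m)) => k.
by rewrite -addn2 exprD hx mulrDr mulr1 -exprSr.
Qed.

(** Matrices supply a root of [x ^ 2 = 1 + x] even when 5 has no square root in [A]. *)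
Lemma golden_mx (A : comNzRingType) : exists Q : 'M[A]_2, Q ^+ 2 = 1 + Q.
Proof.
exists (\matrix_(i, j) ((i + j)%N != 0%N)%:R); apply/matrixP => i j.
rewrite expr2 !mxE !big_ord_recl big_ord0 !mxE.
by case: i => [[|[|//]] ?]; case: j => [[|[|//]] ?] /=;
  rewrite ?(mul0r, mul1r, mulr0, mulr1, add0r, addr0).
Qed.

Lemma fib_prime_modp (p : nat) : prime p -> (p %| fib p.+1)%N ->
  (fib p)%:R = -1 :> 'F_p.
Proof.
move=> hp hF; have chFp := pchar_Fp hp.
have hF0 : (fib p.+1)%:R = 0 :> 'F_p by apply/eqP; rewrite -(dvdn_pcharf chFp).
have [Q hQ] := golden_mx 'F_p.
have chM : p \in [pchar 'M['F_p]_2].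
  exact: (rmorph_pchar (@scalar_mx _ 2)) chFp.
have hQ' : (1 - Q) ^+ 2 = 1 + (1 - Q).
  by rewrite expr2 mulrBl mul1r mulrBr mulr1 -expr2 hQ opprB addrK addrC.
have hcomm : GRing.comm Q (1 - Q) by apply: commrB; [apply: commr1|].
have hpow (x : 'M['F_p]_2) : x ^+ 2 = 1 + x ->
    x ^+ p = (fib p.-1)%:R + x *+ fib p.
  by move/(expr_golden _ _ p.-1); rewrite prednK ?prime_gt0.
have hfib : fib p.+1 = (fib p + fib p.-1)%N by rewrite -(prednK (prime_gt0 hp)).
have := pFrobenius_autD_comm chM hcomm.
rewrite subrKC !pFrobenius_autE expr1n !hpow // addrACA -(mulrnDl _ Q) subrKC -!natrD.
(* [Q] has cancelled; the identity between scalar matrices descends to [1 = fib p.-1 + fib p.+1] in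
   ['F_p]. *)
rewrite -addnA [(_ + fib p)%N]addnC -hfib -(rmorph_nat (@scalar_mx _ 2)).
rewrite -[1](rmorph1 (@scalar_mx _ 2)) => /fmorph_inj.
rewrite natrD hF0 addr0 => h1.
by apply/eqP; rewrite -addr_eq0 [X in _ + X]h1 -natrD -hfib hF0.
Qed.

Definition powers_col (A : comNzRingType) (N : nat) (a b : A) : 'cV[A]_N.+1 :=
  \col_i (a ^+ (N - i) * b ^+ i).

(** After the column reversal [k = N - j], row [i] has entries ['C(i, k)], and its product with the
    vector is [b ^ (N - i)] times the binomial expansion of [(b + a) ^ i]; the terms with [k > i]
    vanish. *)
Lemma mul_Rmat_powers_col (A : comNzRingType) (N : nat) (a b : A) :
  map_mx intr (Rmat N.+1) *m powers_col A N a b = powers_col A N b (a + b).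
Proof.
apply/colP => i; rewrite !mxE (reindex_inj rev_ord_inj) /=.
have hi : (i < N.+1)%N by [].
rewrite addrC exprDn (big_ord_widen N.+1 (fun k : nat =>
  b ^+ (i - k) * a ^+ k *+ 'C(i, k))) // mulr_sumr [RHS]big_mkcond /=.
apply: eq_bigr => k _; rewrite !mxE /= subSS.
have hk : (k <= N)%N by rewrite -ltnS.
rewrite !subSS subKn //; case: ifP => [|/negbT]; rewrite ltnS.
  move=> hki; rewrite mulrnAr mulrA -exprD addnBA // subnK //.
  by rewrite [X in _ * X]mulrC mulr_natl.
by rewrite -ltnNge => hik; rewrite bin_small // mul0r.
Qed.

Lemma expr_Rmat_powers_col (A : comNzRingType) (N m : nat) (a b : A) :
  map_mx intr (Rmat N.+1) ^+ m.+1 *m powers_col A N a b =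
  powers_col A N (a *+ fib m + b *+ fib m.+1) (a *+ fib m.+1 + b *+ fib m.+2).
Proof.
elim: m => [|m IH].
  by rewrite expr1 mul_Rmat_powers_col /= mulr0n add0r.
rewrite exprS -[_ * _]/(_ *m _) -mulmxA IH mul_Rmat_powers_col; congr powers_col.
by rewrite addrACA -!mulrnDr [X in a *+ X]addnC [X in b *+ X]addnC.
Qed.

(** Entry [i] of the product is the generating polynomial of row [i]. An indeterminate is needed:
    ['F_p] has too few points when [N] is large. *)
Lemma powers_col_inj (A : comNzRingType) (N : nat) (M M' : 'M[A]_N.+1) :
  map_mx polyC M *m powers_col {poly A} N 1 'X =
  map_mx polyC M' *m powers_col {poly A} N 1 'X -> M = M'.
Proof.
have coefE (B : 'M[A]_N.+1) i (j : 'I_N.+1) :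
    ((map_mx polyC B *m powers_col {poly A} N 1 'X) i 0)`_j = B i j.
  rewrite mxE coef_sum (bigD1 j) //= big1 => [|k neq_kj]; rewrite !mxE expr1n mul1r.
    by rewrite coefCM coefXn eqxx mulr1 addr0.
  by rewrite coefCM coefXn eq_sym (inj_eq val_inj) (negPf neq_kj) mulr0.
by move=> eqMM'; apply/matrixP => i j; rewrite -!coefE eqMM'.
Qed.

Lemma expr_Rmat_modp (p N : nat) : prime p -> (p %| fib p.+1)%N ->
  map_mx intr (Rmat N.+1) ^+ p.+1 = ((-1) ^+ N)%:M :> 'M['F_p]_N.+1.
Proof.
move=> hp hF; apply: powers_col_inj.
have chX : p \in [pchar {poly 'F_p}] by rewrite (rmorph_pchar polyC) ?pchar_Fp.
have hF0 (x : {poly 'F_p}) : x *+ fib p.+1 = 0.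
  by apply/eqP; rewrite -mulr_natr mulf_eq0 -(dvdn_pcharf chX) hF orbT.
have hFp (x : {poly 'F_p}) : x *+ fib p = - x.
  rewrite -mulr_natr -(rmorph_nat polyC) fib_prime_modp //.
  by rewrite rmorphN1 mulrN1.
rewrite rmorphXn /= -map_mx_comp (eq_map_mx _ (rmorph_int polyC)).
rewrite expr_Rmat_powers_col /= !mulrnDr !hF0 !hFp ?add0r ?addr0.
rewrite map_scalar_mx mul_scalar_mx; apply/colP => i; rewrite !mxE.
have hiN : (i <= N)%N by rewrite -ltnS.
(* The signs of [(-1) ^ (N - i)] and [(- 'X) ^ i] combine into [(-1) ^ N], the same for every
   [i]. *)
rewrite (exprNn 'X) mulrA -exprD subnK // expr1n mul1r.
by rewrite rmorphXn /= rmorphN1.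
Qed.

Lemma eqmod_mx_Fp (p m n : nat) (A B : 'M[int]_(m, n)) : prime p ->
  map_mx intr A = map_mx intr B :> 'M['F_p]_(m, n) -> eqmod_mx p A B.
Proof.
move=> hp eqAB i j; apply/eqP; rewrite eqz_mod_dvd (dvdz_pcharf (pchar_Fp hp)).
by move/matrixP/(_ i j): eqAB; rewrite !mxE rmorphB /= => ->; rewrite subrr.
Qed.

Theorem theorem12 (p : nat) (hp : prime p) (hF : (p %| fib p.+1)%N) :
  (forall k : nat,
     eqmod_mx p (Rmat (2 * k + 1)%N ^+ p.+1) 1%:M) /\
  (forall k : nat, (1 <= k)%N ->
     eqmod_mx p (Rmat (2 * k)%N ^+ p.+1) (- 1%:M)).
Proof.
(* The size is [N.+1], so odd sizes have even [N] and sign [+1], even sizes sign [-1]. *)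
have modp N : eqmod_mx p (Rmat N.+1 ^+ p.+1) ((-1) ^+ N)%:M.
  apply: eqmod_mx_Fp => //.
  by rewrite rmorphXn /= expr_Rmat_modp // map_scalar_mx /= [in RHS]rmorph_sign.
split=> [k|[//|k] _].
  by have := modp (2 * k)%N; rewrite exprM sqrrN !expr1n addn1.
have := modp (2 * k).+1%N.
by rewrite [(-1) ^+ _]exprS exprM sqrrN !expr1n mulr1 raddfN mulnS.
Qed.
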